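(* Let $G=(V,E)$ be a finite undirected graph and let $\underline{h}=(h_i)_{i\in V}$ with $h_i\ge 0$. Consider the asynchronous Glauber (heat-bath) dynamics on $\{+1,-1\}^V$ at inverse noise level $\beta>0$, and let $\tau_+(G;\underline{h})$ be its typical hitting time of the all-$(+1)$ configuration. For an induced subgraph $F\subseteq G$ define $\underline{h}^F$ on $V(F)$ by $h^F_i=h_i+|\partial i|_{G\setminus F}$, where $|\partial i|_{G\setminus F}$ is the number of neighbours of $i$ in $G$ lying outside $V(F)$. Then, as $\beta\to\infty$ (with $G,\underline{h}$ fixed), $$\tau_+(G;\underline{h})=\exp\{2\beta\,\Gamma_*(G;\underline{h})+o(\beta)\},\qquad \Gamma_*(G;\underline{h})=\max_{F\subseteq G}\Gamma(F;\underline{h}^F)=\max_{F\subseteq G}\Delta(F;\underline{h}^F),$$ the maxima being over induced subgraphs $F$ of $G$.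
   Context: For $U\subseteq V$, $|U|_h=\sum_{i\in U}h_i$, and ${\rm cut}(S,V\setminus S)$ is the number of edges between $S$ and $V\setminus S$. Glauber dynamics: each vertex $i$ carries an independent rate-1 Poisson clock; when it rings, $x_i$ is replaced by $y_i\in\{\pm1\}$ with probability $(1+e^{-2\beta K_i(\underline{x})y_i})^{-1}$, where $K_i(\underline{x})=h_i+\sum_{j\in\partial i}x_j$ and $\partial i$ is the neighbourhood of $i$. This chain is reversible w.r.t. $\mu_\beta(\underline{x})\propto e^{-\beta H(\underline{x})}$, $H(\underline{x})=-\sum_{(i,j)\in E}x_ix_j-\sum_i h_ix_i$. With $T_+$ the hitting time of the all-$(+1)$ configuration, $\tau_+(G;\underline{h})=\sup_{\underline{x}}\inf\{t\ge0:\mathbb{P}^{\underline{x}}_\beta\{T_+\ge t\}\le e^{-1}\}$. Tilted cutwidth: with $n=|V|$, $\Gamma(G;\underline{h})=\min_{i(1),\dots,i(n)}\max_{0\le t\le n}[{\rm cut}(S_t,V\setminus S_t)-|S_t|_h]$, the min over linear orderings of $V$ and $S_t=\{i(1),\dots,i(t)\}$. Tilted cut: for $\Omega\subseteq 2^V$ with $\emptyset\in\Omega$, $V\notin\Omega$, let $\partial\Omega$ be the set of pairs $(S,S\cup\{i\})$ with $S\in\Omega$, $S\cup\{i\}\notin\Omega$; then $\Delta(G;\underline{h})=\max_\Omega\min_{(S_1,S_2)\in\partial\Omega}\max_{i=1,2}[{\rm cut}(S_i,V\setminus S_i)-|S_i|_h]$, the max over monotone (down-closed: $S\in\Omega$,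 $S'\subseteq S$ imply $S'\in\Omega$) such $\Omega$. For a subgraph $F$ these quantities are computed in $F$ with weights $\underline{h}^F$. *)

(* Defs.v *)
From HB Require Import structures.
From mathcomp Require Import all_boot all_order all_algebra all_fingroup.
From mathcomp Require Import all_classical all_reals all_analysis.
Set Implicit Arguments. Unset Strict Implicit. Unset Printing Implicit Defensive.
Import Order.TTheory GRing.Theory Num.Theory.
Local Open Scope ring_scope.

(* A finite simple graph is a symmetric irreflexive relation E on a finType V. *)

Section Graph.
Variables (R : realType) (T : finType) (E : rel T) (h : T -> R).

(* cut(S, T \ S): number of edges with one end in S and the other outside;
   each undirected edge counted once (as the ordered pair (inside, outside)). *)
Definition cut (S : {set T}) : nat :=
  #|[set p : T * T | [&& E p.1 p.2, p.1 \in S & p.2 \notin S]]|.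

Definition hweight (S : {set T}) : R := \sum_(i in S) h i.

Definition tilt (S : {set T}) : R := (cut S)%:R - hweight S.

(* Tilted cutwidth: min over linear orderings (a permutation p lists the
   vertices as p x_1, ..., p x_n, with x_1..x_n = enum T), max over 0<=t<=n. *)
Local Notation permT := (perm_of T).
Definition Gamma : \bar R :=
  \big[mine/+oo%E]_(p : permT)
     \big[maxe/-oo%E]_(t < #|T|.+1)
        (tilt [set x in take t [seq p i | i <- enum T]])%:E.

Local Notation setT_ := {set T}.
Local Notation setsetT := {set {set T}}.
Definition down_closed (Om : {set {set T}}) : bool :=
  [forall S in Om, forall S' : {set T}, (S' \subset S) ==> (S' \in Om)].

(* Tilted cut: boundary pairs (S, S u {i}) with S in Om, S u {i} notin Om
   are indexed by (S, i). *)
Definition Delta : \bar R :=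
  \big[maxe/-oo%E]_(Om : setsetT |
       [&& down_closed Om, finset.set0 \in Om & [set: T] \notin Om])
     \big[mine/+oo%E]_(Si : (setT_ * T)%type |
          (Si.1 \in Om) && (Si.2 |: Si.1 \notin Om))
        maxe (tilt Si.1)%:E (tilt (Si.2 |: Si.1))%:E.

End Graph.

Definition indE (V : finType) (E : rel V) (A : {set V}) : rel {x : V | x \in A} :=
  fun u v => E (val u) (val v).

Definition hF (R : realType) (V : finType) (E : rel V) (h : V -> R) (A : {set V})
  : {x : V | x \in A} -> R :=
  fun u => h (val u) + #|[set j | E (val u) j & j \notin A]|%:R.

Arguments indE [V] E A.
Arguments hF [R V] E h A.

Definition Gamma_star (R : realType) (V : finType) (E : rel V) (h : V -> R) : \bar R :=
  \big[maxe/-oo%E]_(A : {set V} | A != finset.set0) Gamma (indE E A) (hF E h A).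

Definition Delta_star (R : realType) (V : finType) (E : rel V) (h : V -> R) : \bar R :=
  \big[maxe/-oo%E]_(A : {set V} | A != finset.set0) Delta (indE E A) (hF E h A).

Section Glauber.
Variables (R : realType) (V : finType) (E : rel V) (h : V -> R) (beta : R).

Definition config := {ffun V -> bool}.
Definition spin (b : bool) : R := if b then 1 else -1.
Definition allplus : config := [ffun => true].

Definition Kfield (x : config) (i : V) : R := h i + \sum_(j | E i j) spin (x j).

Definition hb_prob (x : config) (i : V) (s : bool) : R :=
  (1 + expR (- (2 * beta * Kfield x i * spin s)))^-1.

Definition upd (x : config) (i : V) (s : bool) : config :=
  [ffun j => if j == i then s else x j].

(* Embedded jump chain (uniformisation): the superposition of the n = |V|
   independent rate-1 clocks rings at rate n, each ring being the clock of a
   uniformly chosen vertex, which is then updated by the heat-bath rule.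
   surv_disc k x = P^x{ Y_0, ..., Y_k all differ from the all-plus config }. *)
Fixpoint surv_disc (k : nat) (x : config) : R :=
  if x == allplus then 0 else
  match k with
  | 0 => 1
  | k'.+1 => (#|V|%:R)^-1 *
        \sum_(i : V) \sum_(s : bool) hb_prob x i s * surv_disc k' (upd x i s)
  end.

(* P^x{T_+ >= t}: for t > 0 this is P^x{X_s != + for all s < t}
   = sum_k P(N_{t-} = k) surv_disc k x, with N_{t-} ~ Poisson(n t). *)
Definition surv (x : config) (t : R) : R :=
  if t == 0 then 1 else
  limn (fun N => \sum_(k < N)
     (expR (- (#|V|%:R * t)) * (#|V|%:R * t) ^+ k / (k`!)%:R) * surv_disc k x).

Definition tau_plus : R :=
  \big[Num.max/0]_(x : config)
     inf [set t : R | 0 <= t /\ surv x t <= expR (-1)].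

End Glauber.

(* Main.v *)
(* Write f(S) = cut(S, V \ S) - |S|_h, so that the energy is 2 f(S) up to a
   constant when S is the set of plus spins. The function f is submodular.

   Combinatorics. If no increasing path joins B to V below level L, let Om be the
   down-closure of the sets reachable from B by increasing paths below level L.
   A boundary pair (S, S + i) of Om below level L with S of maximal size cannot
   exist: S lies in a reachable C, and either all X between S and C satisfy
   f(S) <= f(X), and then intersecting with S a path to C gives a path to S, or
   some X has f(X) < f(S), and then (X, X + i) is a larger such pair. Hence
   Gamma = Delta for every graph. On the subgraph induced by A the tilted cut of
   S is f(S + A^c) - f(A^c), so Gamma_* is the largest barrier from B = A^c to V
   along increasing paths, over all B <> V.

   Lower bound. A set B nearly attaining Gamma_* can be taken with minimal f among
   its subsets. Then f(S + B) <= f(S) for all S, so that all boundary pairs of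
   the family Om, in the whole cube, are above level f(B) + Gamma_* - eps. The
   stationary flow out of Om bounds the probability of leaving Om from B.

   Upper bound. A Poincare inequality along the increasing paths, for functions
   vanishing at the all-plus configuration, gives exponential decay at rate
   exp(- 2 beta Gamma_* ) up to a constant. The loss from L^2 to a pointwise bound
   costs a factor exp(O(beta)), hence only a factor O(beta) in time. *)

Require Import Defs.
From HB Require Import structures.
From mathcomp Require Import all_boot all_order all_algebra.
From mathcomp Require Import perm.
From mathcomp Require Import all_classical all_reals all_analysis.
From mathcomp Require Import ring lra.
Import Order.TTheory GRing.Theory Num.Theory.
Import numFieldNormedType.Exports.
(* [all_classical] shadows the names of the lemmas on finite sets. *)
Import mathcomp.boot.finset.
Set Implicit Arguments. Unset Strict Implicit. Unset Printing Implicit Defensive.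
Local Open Scope ring_scope.

(** * Increasing paths of sets below an energy level *)

Section Reach.
Variables (R : realType) (T : finType) (f : {set T} -> R).

Definition submodular := forall A B, f (A :|: B) + f (A :&: B) <= f A + f B.

Inductive reach (L : R) (B : {set T}) : {set T} -> Prop :=
| reach_start : f B <= L -> reach L B B
| reach_step S i : reach L B S -> i \notin S -> f (i |: S) <= L ->
    reach L B (i |: S).

Lemma reach_le L B S : reach L B S -> f S <= L.
Proof. by case. Qed.

Lemma reach_start_le L B S : reach L B S -> f B <= L.
Proof. by elim. Qed.

Lemma reach_sup L B S : reach L B S -> B \subset S.
Proof.
by elim=> // {}S i _ BS _ _; apply: (fintype.subset_trans BS); apply: subsetUr.
Qed.

Lemma reach_add L B S i : reach L B S -> f (i |: S) <= L -> reach L B (i |: S).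
Proof.
move=> rS fi; have [iS|iS] := boolP (i \in S); last exact: reach_step.
by rewrite (setUidPr _) ?sub1set.
Qed.

(** Intersect each stage of the path with [S]. The union of a stage with [S] lies between [S] and
    [C0], so its energy is at least [f S]; submodularity then gives the intersection an energy no
    larger than that of the stage itself. *)
Lemma reach_capped L (B S C0 : {set T}) : submodular ->
  (forall X : {set T}, S \subset X -> X \subset C0 -> f S <= f X) ->
  B \subset S -> S \subset C0 ->
  forall C, reach L B C -> C \subset C0 -> reach L B (C :&: S).
Proof.
move=> sub min_S BS SC0 C; elim=> [fB|{}C i rC IH iC fi] CC0.
  by rewrite (setIidPl BS); apply: reach_start.
have CC0' : C \subset C0 by apply: fintype.subset_trans CC0; apply: subsetUr.
rewrite setIUl; have [iS|iS] := boolP (i \in S); last first.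
  have -> : [set i] :&: S = set0.
    by apply/setP=> x; rewrite !inE; case: eqP => // ->; rewrite (negbTE iS).
  by rewrite set0U; apply: IH.
rewrite (setIidPl (_ : [set i] \subset S)) ?sub1set//.
apply: reach_add; first exact: IH.
have -> : i |: C :&: S = (i |: C) :&: S.
  by rewrite setIUl (setIidPl (_ : [set i] \subset S)) ?sub1set.
have : f S <= f ((i |: C) :|: S).
  by apply: min_S; [exact: subsetUr | rewrite subUset CC0].
by have := sub (i |: C) S; lra.
Qed.

(** Stability of [Om] under union with [B] serves the lower bound on the hitting time: it transfers
    the barrier from pairs containing [B] to all boundary pairs. *)
Lemma reach_cut L B : submodular -> B != setT -> ~ reach L B setT ->
  exists Om : {set {set T}},
    [/\ B \in Om, setT \notin Om,
        forall S S' : {set T}, S \in Om -> S' \subset S -> S' \in Om,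
        forall S, S \in Om -> S :|: B \in Om &
        forall (S : {set T}) i, B \subset S -> S \in Om -> i |: S \notin Om ->
          L < f S \/ L < f (i |: S)].
Proof.
move=> sub BT nreach.
(* The first disjunct keeps [B] in [Om] even when [f B > L], in which case nothing is reachable. *)
pose Om := [set S : {set T} | (S \subset B) ||
              `[< exists2 C, reach L B C & S \subset C >]].
exists Om; split.
- by rewrite inE fintype.subxx.
- rewrite inE negb_or; apply/andP; split.
    by apply: contraNN BT; rewrite subTset.
  by apply/asboolP => -[C rC]; rewrite subTset => /eqP CT; apply: nreach; rewrite -CT.
- move=> S S'; rewrite !inE => /orP[SB|/asboolP[C rC SC]] S'S.
    by rewrite (fintype.subset_trans S'S SB).
  by apply/orP; right; apply/asboolP; exists C => //; apply: fintype.subset_trans SC.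
- move=> S; rewrite !inE !subUset fintype.subxx andbT => /orP[->//|/asboolP[C rC SC]].
  apply/orP; right; apply/asboolP; exists C => //.
  by rewrite subUset SC; apply: reach_sup rC.
move=> S1 i1 BS1 S1Om iS1Om.
have [|fS1] := ltP L (f S1); first by left.
have [|fi1] := ltP L (f (i1 |: S1)); first by right.
exfalso.
(* The added vertex [i1] stays fixed while [S] is taken of maximal size. *)
pose bad (S : {set T}) := [&& B \subset S, S \in Om, i1 |: S \notin Om, f S <= L & f (i1 |: S) <= L].
have bad1 : bad S1 by rewrite /bad BS1 S1Om iS1Om fS1 fi1.
case: (arg_maxnP (fun S : {set T} => #|S|) bad1) => S.
move=> /and5P[BS SOm iSOm fS fi] maxS.
have nrS : ~ reach L B S.
  move=> rS; move/negP: iSOm; apply; rewrite inE; apply/orP; right; apply/asboolP.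
  by exists (i1 |: S) => //; apply: reach_add.
have [rB|nrB] := pselect (reach L B B); last first.
  have SB : S = B.
    apply/eqP; rewrite eqEsubset BS andbT; move: SOm; rewrite inE => /orP[//|].
    by move=> /asboolP[C /reach_start_le fB]; case: nrB; apply: reach_start.
  by apply: nrB; apply: reach_start; rewrite -SB.
have [C rC SC] : exists2 C, reach L B C & S \subset C.
  by move: SOm; rewrite inE => /orP[SB|/asboolP//]; exists B.
have iC : i1 \notin C.
  apply: contraNN iSOm => iC; rewrite inE; apply/orP; right; apply/asboolP.
  by exists C => //; rewrite subUset sub1set iC.
(* Submodularity for [X] and [i1 |: S], whose intersection is [S], shows that adding [i1] raises the
   energy of [X] by no more than that of [S]. A cheaper [X] would thus be a larger bad set. *)
have minS (X : {set T}) : S \subset X -> X \subset C -> f S <= f X.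
  move=> SX XC; rewrite leNgt; apply/negP => ltXS.
  have iX : i1 \notin X by apply: contraNN iC => /(fintype.subsetP XC).
  have sub2 := sub X (i1 |: S).
  have e1 : X :|: (i1 |: S) = i1 |: X by rewrite setUCA (setUidPl SX).
  have e2 : X :&: (i1 |: S) = S.
    apply/setP=> x; rewrite !inE; case: (eqVneq x i1) => [->|_] /=.
      by rewrite (negbTE iX); apply/esym/negbTE; apply: contraNN iX => /(fintype.subsetP SX).
    by apply: andb_idl => /(fintype.subsetP SX).
  rewrite e1 e2 in sub2.
  have badX : bad X.
    rewrite /bad (fintype.subset_trans BS SX) /=; apply/and4P; split.
    - by rewrite inE; apply/orP; right; apply/asboolP; exists C.
    - apply: contraNN iSOm; rewrite !inE => /orP[H|/asboolP[D rD XD]]; apply/orP.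
        by left; apply: fintype.subset_trans H; apply: setUS.
      by right; apply/asboolP; exists D => //; apply: fintype.subset_trans XD; apply: setUS.
    - lra.
    - lra.
  have /= := maxS _ badX; rewrite leqNgt => /negP; apply; apply: proper_card.
  by rewrite properEneq SX andbT; apply: contraTneq ltXS => ->; rewrite ltxx.
by apply: nrS; rewrite -(setIidPr SC); exact: (reach_capped sub minS BS SC rC).
Qed.

Lemma reach_crosses L B S (Om : {set {set T}}) :
  reach L B S -> B \in Om -> S \notin Om ->
  exists S' i, [/\ S' \in Om, i |: S' \notin Om, f S' <= L & f (i |: S') <= L].
Proof.
move=> rS BOm; elim: rS => [|{}S i rS IH iS fi]; first by rewrite BOm.
move=> iSOm; have [SOm|/IH//] := boolP (S \in Om).
by exists S, i; split=> //; apply: reach_le rS.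
Qed.

(** The stages of a path from the empty set are the prefixes of a list of vertices, the form in
    which orderings enter [Gamma]. *)
Lemma reachP L S : reach L set0 S <->
  exists2 s : seq T, uniq s /\ S = [set x in s] &
    forall t, f [set x in take t s] <= L.
Proof.
split.
  elim=> [f0|{}S i _ [s [us ->] fs] iS fi].
    exists [::]; first by split=> //; apply/setP => x; rewrite !inE.
    by move=> t; rewrite (_ : [set x in _] = set0)//; apply/setP => x; rewrite !inE.
  have es : i |: [set x in s] = [set x in rcons s i].
    by apply/setP=> x; rewrite !inE mem_rcons inE.
  exists (rcons s i).
    by rewrite rcons_uniq us andbT; split => //; rewrite inE in iS.
  move=> t; have [ts|ts] := leqP t (size s).
    by rewrite -cats1 takel_cat.
  by rewrite take_oversize ?size_rcons// -es.
case=> s [us ->] fs; rewrite -[s in [set x in s]]take_size.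
elim: {-2}(size s) (leqnn (size s)) => [|k IH] ks.
  have e0 : [set x in take 0 s] = set0 by apply/setP => x; rewrite take0 !inE.
  by rewrite e0; apply: reach_start; rewrite -e0.
case: s us fs ks IH => // x0 s; set s' := x0 :: s => us fs ks IH.
have ek : [set x in take k.+1 s'] = nth x0 s' k |: [set x in take k s'].
  by apply/setP=> x; rewrite (take_nth x0)// !inE mem_rcons inE.
rewrite ek; apply: reach_add; first by apply: IH; apply: ltnW.
by rewrite -ek.
Qed.

End Reach.

(** * Equality of the tilted cutwidth and the tilted cut *)

Lemma le_fin_ext (R : realType) (x y : \bar R) :
  (forall r : R, (x <= r%:E)%E <-> (y <= r%:E)%E) -> x = y.
Proof.
have le (a b : \bar R) : (forall r : R, (a <= r%:E)%E -> (b <= r%:E)%E) -> (b <= a)%E.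
  case: a => [a|_|ab]; [exact | exact: leey |].
  by rewrite leeNy_eq; apply/eqP/eq_ninfty => r; apply: ab; rewrite leNye.
by move=> xy; apply/eqP; rewrite eq_le !le// => r /xy.
Qed.

Section Tilt.
Variables (R : realType) (T : finType) (E : rel T) (h : T -> R).

Let ind (S : {set T}) x : R := (x \in S)%:R.

(** As a polynomial in indicators, the tilted cut can be compared term by term, with [ring] and case
    analysis on membership. *)
Lemma tiltE S : tilt E h S =
  \sum_x (\sum_y (E x y)%:R * ind S x * (1 - ind S y)) - \sum_x ind S x * h x.
Proof.
rewrite /tilt /hweight; congr (_ - _); last first.
  by rewrite big_mkcond; apply: eq_bigr => x _; rewrite /ind; case: (x \in S); rewrite ?mul1r ?mul0r.
rewrite /Defs.cut -sum1_card natr_sum pair_big /= big_mkcond.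
apply: eq_bigr => -[x y] _; rewrite inE /ind /=.
by case: (E x y); case: (x \in S); case: (y \in S) => /=;
  rewrite ?mul1r ?mul0r ?subr0 ?subrr ?mulr0.
Qed.

Lemma tilt_set0 : tilt E h set0 = 0.
Proof.
by rewrite tiltE !big1 ?subr0// => x _; rewrite ?big1// => *; rewrite /ind inE ?mulr0 mul0r.
Qed.

(** The field part is modular and cancels; each ordered pair [(x, y)] then contributes a nonnegative
    amount, whichever of the two sets contain [x] and [y]. *)
Lemma tilt_submodular : submodular (tilt E h).
Proof.
move=> A B; rewrite !tiltE -subr_ge0.
set u := (X in 0 <= X).
have -> : u = \sum_x (\sum_y (E x y)%:R *
   (ind A x * (1 - ind A y) + ind B x * (1 - ind B y)
   - ind (A :|: B) x * (1 - ind (A :|: B) y) - ind (A :&: B) x * (1 - ind (A :&: B) y)))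
   - \sum_x (ind A x + ind B x - ind (A :|: B) x - ind (A :&: B) x) * h x.
  have dist (a b c d a' b' c' d' : R) :
      c - c' + (d - d') - (a - a' + (b - b')) = c + d - a - b - (c' + d' - a' - b').
    by ring.
  rewrite /u dist; congr (_ - _).
    rewrite -!sumrN -!big_split /=; apply: eq_bigr => x _.
    rewrite -!sumrN -!big_split /=; apply: eq_bigr => y _; ring.
  by rewrite -!sumrN -!big_split /=; apply: eq_bigr => x _; ring.
rewrite [X in _ - X]big1 => [|x _]; last first.
  by rewrite /ind !inE; case: (x \in A); case: (x \in B) => /=; ring.
rewrite subr0; apply: sumr_ge0 => x _; apply: sumr_ge0 => y _.
apply: mulr_ge0; first by rewrite ler0n.
rewrite /ind !inE.
by case: (x \in A); case: (x \in B); case: (y \in A); case: (y \in B) => /=; lra.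
Qed.

Lemma Gamma_le (L : R) : (Gamma E h <= L%:E)%E <-> reach (tilt E h) L set0 setT.
Proof.
rewrite reachP; split.
  move=> /bigmin_leP[//|[p _ /bigmax_leP[_ fp]]].
  exists [seq p i | i <- enum T].
    split; first by rewrite map_inj_uniq ?enum_uniq//; apply: perm_inj.
    apply/setP=> x; rewrite !inE; apply/esym/mapP.
    by exists ((p^-1)%g x); rewrite ?mem_enum// permKV.
  move=> t; have [tT|tT] := ltnP t #|T|.+1.
    by have := fp (Ordinal tT) isT; rewrite lee_fin.
  have szp : size [seq p i | i <- enum T] = #|T| by rewrite size_map -cardE.
  by have := fp ord_max isT; rewrite lee_fin !take_oversize ?szp// ltnW.
case=> s [us sT] fs.
have ss : size s = #|T|.
  by rewrite -(card_uniqP us); apply: eq_card => x; have := in_setT x; rewrite sT !inE.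
(* [g] sends a vertex to the entry of [s] with the same rank in [enum T]. The default of [nth] is
   never met, as [s] has [#|T|] entries. *)
pose g i := nth i s (index i (enum T)).
have gi : injective g.
  move=> i j; rewrite /g (set_nth_default j) ?ss ?cardE ?index_mem ?mem_enum//.
  move/eqP; rewrite nth_uniq ?ss ?cardE ?index_mem ?mem_enum// => /eqP.
  by apply: index_inj; rewrite ?mem_enum.
have gs : [seq perm gi i | i <- enum T] = s.
  case: (pickP (mem T)) => [x0 _|T0]; last first.
    have T0' : #|T| = 0%N by apply: eq_card0.
    rewrite (size0nil (_ : size s = 0%N)) ?ss//.
    by rewrite (size0nil (_ : size (enum T) = 0%N)) -?cardE.
  apply: (@eq_from_nth _ x0); rewrite size_map -?cardE ?ss// => k kT.
  rewrite (nth_map x0) -?cardE// permE /g index_uniq ?enum_uniq -?cardE//.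
  by apply: set_nth_default; rewrite ss.
apply/bigmin_leP; right; exists (perm gi) => //.
by apply/bigmax_leP; split => [|t _]; rewrite ?leNye// lee_fin gs.
Qed.

(** At each finite level, a path to the full set must cross the boundary of every admissible [Om];
    if there is no path, [reach_cut] from the empty set yields an [Om] whose boundary is too high.
    Without vertices no [Om] is admissible, and the two sides would be 0 and [-oo]. *)
Lemma Gamma_eq_Delta : (0 < #|T|)%N -> Gamma E h = Delta E h.
Proof.
move=> T0.
have T0' : set0 != setT :> {set T}.
  by apply: contraTneq T0 => e; rewrite -cardsT -e cards0.
apply: le_fin_ext => L; rewrite Gamma_le; split.
  move=> rT; apply/bigmax_leP; split=> [|Om /and3P[_ Om0 OmT]]; first exact: leNye.
  have [S [i [SOm iSOm fS fi]]] := reach_crosses rT Om0 OmT.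
  apply/bigmin_leP; right; exists (S, i); rewrite /= ?SOm ?iSOm//.
  by rewrite ge_max !lee_fin fS fi.
move=> /bigmax_leP[_ DL]; apply: contrapT.
move=> /(reach_cut tilt_submodular T0')[Om [Om0 OmT Omd _ Omb]].
have : [&& down_closed Om, set0 \in Om & setT \notin Om].
  rewrite Om0 OmT !andbT; apply/forall_inP => S SOm; apply/forallP => S'.
  by apply/implyP; apply: Omd SOm.
move=> /DL /bigmin_leP[//|[[S i] /= /andP[SOm iSOm]]].
rewrite ge_max !lee_fin => /andP[fS fi].
by have [] := Omb S i (sub0set _) SOm iSOm; lra.
Qed.

End Tilt.

Lemma Gamma_star_eq_Delta_star (R : realType) (V : finType) (E : rel V) (h : V -> R) :
  Gamma_star E h = Delta_star E h.
Proof.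
apply: eq_bigr => A /set0Pn[x xA]; apply: Gamma_eq_Delta.
by rewrite card_sig; apply/card_gt0P; exists x.
Qed.

(** * Induced subgraphs as paths started from the complement *)

Section Subgraph.
Variables (R : realType) (V : finType) (E : rel V) (h : V -> R).
Hypothesis Esym : symmetric E.

Lemma sum_sig (A : {set V}) (F : V -> R) :
  \sum_(u : {x | x \in A}) F (val u) = \sum_x (x \in A)%:R * F x.
Proof.
rewrite [RHS](eq_bigr (fun x => if x \in A then F x else 0)); last first.
  by move=> x _; case: (x \in A); rewrite ?mul1r ?mul0r.
by rewrite -big_mkcond [RHS]big_sub.
Qed.

(** Passing from [~: A] to [C] removes from the cut the edges between [~: A] and [C :&: A], which is
    what the extra field in [hF] counts. *)
Lemma tilt_sub (A C : {set V}) : ~: A \subset C ->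
  tilt (indE E A) (hF E h A) (val @^-1: C) = tilt E h C - tilt E h (~: A).
Proof.
move=> AC; rewrite !tiltE /indE /hF.
pose a x : R := (x \in A)%:R; pose c x : R := (x \in C)%:R.
pose e x y : R := (E x y)%:R.
have esym x y : e x y = e y x by rewrite /e Esym.
have subE : \sum_(u : {x | x \in A}) \sum_(v : {x | x \in A}) (E (val u) (val v))%:R *
      (u \in val @^-1: C)%:R * (1 - (v \in val @^-1: C)%:R) =
    \sum_x \sum_y a x * a y * (e x y * c x * (1 - c y)).
  transitivity (\sum_(u : {x | x \in A}) \sum_y a y * (e (val u) y * c (val u) * (1 - c y))).
    by apply: eq_bigr => u _; rewrite -sum_sig; apply: eq_bigr => v _; rewrite !inE.
  rewrite (sum_sig A (fun x => \sum_y a y * (e x y * c x * (1 - c y)))).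
  by apply: eq_bigr => x _; rewrite mulr_sumr; apply: eq_bigr => y _; rewrite mulrA.
have hE : \sum_(u : {x | x \in A}) (u \in val @^-1: C)%:R *
      (h (val u) + #|[set j | E (val u) j & j \notin A]|%:R) =
    \sum_x a x * (c x * h x) + \sum_x \sum_y a x * c x * (e x y * (1 - a y)).
  rewrite -big_split /= (eq_bigr (fun x => a x *
      (c x * (h x + \sum_y e x y * (1 - a y))))); last first.
    by move=> x _; rewrite !mulrDr; congr (_ + _); rewrite !mulr_sumr;
      apply: eq_bigr => y _; ring.
  rewrite -(sum_sig A (fun x => c x * (h x + \sum_y e x y * (1 - a y)))).
  apply: eq_bigr => u _; rewrite inE; congr (_ * (_ + _)).
  rewrite -sum1_card natr_sum big_mkcond; apply: eq_bigr => y _; rewrite !inE /e /a.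
  by case: (E _ y); case: (y \in A); rewrite /= ?subr0 ?subrr ?mulr1 ?mulr0 ?mul0r.
rewrite subE hE; apply/eqP; rewrite -subr_eq0; apply/eqP.
pose d x y := e x y * (c x * (1 - c y) - (1 - a x) * a y - a x * a y * (c x * (1 - c y))
   + a x * c x * (1 - a y)).
have iE x : (x \in ~: A)%:R = 1 - a x.
  by rewrite inE /a; case: (x \in A); rewrite ?subr0 ?subrr.
have ca x : c x * a x = c x - (1 - a x).
  rewrite /c /a; have := fintype.subsetP AC x; rewrite inE.
  by case: (x \in A); case: (x \in C) => /= H; try (by have := H isT); ring.
(* The defect [d] does not vanish termwise: it is [d x y + d y x] that is zero, and this is where
   the symmetry of [E] enters. *)
have d0 : \sum_x \sum_y d x y = 0.
  have : \sum_x \sum_y d x y + \sum_x \sum_y d x y = 0.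
    rewrite [in X in _ + X]exchange_big -big_split big1 //= => x _.
    rewrite -big_split big1 //= => y _; rewrite /d (esym y x).
    have := fintype.subsetP AC x; have := fintype.subsetP AC y; rewrite !inE /a /c.
    case: (x \in A); case: (x \in C); case: (y \in A); case: (y \in C) => //= p q;
     try (by have := p isT); try (by have := q isT); ring.
  lra.
rewrite -[RHS]oppr0 -[X in _ = - X]d0.
transitivity (\sum_x \sum_y a x * a y * (e x y * c x * (1 - c y))
   - (\sum_x a x * (c x * h x) + \sum_x \sum_y a x * c x * (e x y * (1 - a y)))
   - (\sum_x \sum_y e x y * c x * (1 - c y) - \sum_x c x * h x
      - (\sum_x \sum_y e x y * (1 - a x) * a y - \sum_x (1 - a x) * h x))).
  congr (_ - (_ - (_ - _))).
  - by apply: eq_bigr => x _; apply: eq_bigr => y _; rewrite !iE; congr (_ * _); ring.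
  - by apply: eq_bigr => x _; rewrite iE.
have -> : \sum_x a x * (c x * h x) = \sum_x c x * h x - \sum_x (1 - a x) * h x.
  by rewrite -sumrN -big_split; apply: eq_bigr => x _ /=; rewrite mulrA (mulrC (a x)) ca; ring.
have -> : \sum_x \sum_y d x y = \sum_x \sum_y e x y * c x * (1 - c y)
   - \sum_x \sum_y e x y * (1 - a x) * a y
   - \sum_x \sum_y a x * a y * (e x y * c x * (1 - c y))
   + \sum_x \sum_y a x * c x * (e x y * (1 - a y)).
  rewrite -!sumrN -!big_split /=; apply: eq_bigr => x _.
  by rewrite -!sumrN -!big_split /=; apply: eq_bigr => y _; rewrite /d; ring.
ring.
Qed.

Lemma reach_sub (A : {set V}) (L : R) (S : {set {x | x \in A}}) :
  reach (tilt (indE E A) (hF E h A)) L set0 S ->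
  reach (tilt E h) (tilt E h (~: A) + L) (~: A) (val @: S :|: ~: A).
Proof.
have imK (S' : {set {x | x \in A}}) : val @^-1: (val @: S' :|: ~: A) = S'.
  apply/setP=> u; rewrite !inE (mem_imset _ _ val_inj) (valP u) orbF.
  by [].
have tiltS (S' : {set {x | x \in A}}) :
    tilt E h (val @: S' :|: ~: A) = tilt E h (~: A) + tilt (indE E A) (hF E h A) S'.
  by rewrite -{2}(imK S') tilt_sub ?subsetUr// addrC subrK.
elim=> [t0|{}S i rS IH iS ti].
  by rewrite imset0 set0U; apply: reach_start; rewrite lerDl -(tilt_set0 (indE E A) (hF E h A)).
rewrite imsetU imset_set1 -setUA; apply: reach_add IH _.
by rewrite setUA -imset_set1 -imsetU tiltS lerD2l.
Qed.

Lemma sub_reach (A : {set V}) (L : R) (C : {set V}) :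
  reach (tilt E h) (tilt E h (~: A) + L) (~: A) C ->
  reach (tilt (indE E A) (hF E h A)) L set0 (val @^-1: C).
Proof.
elim=> [tA|{}C i rC IH iC ti].
  rewrite (_ : _ @^-1: _ = set0); last first.
    by apply/setP=> u; rewrite !inE (valP u).
  by apply: reach_start; rewrite tilt_set0; rewrite lerDl in tA.
have AC := reach_sup rC.
have iA : i \in A.
  by apply: contraNT iC => iA; apply: (fintype.subsetP AC); rewrite inE.
have e : val @^-1: (i |: C) = exist _ i iA |: val @^-1: C :> {set {x | x \in A}}.
  by apply/setP=> u; rewrite !inE -val_eqE.
rewrite e; apply: reach_add => //; rewrite -e tilt_sub; first by lra.
by apply: (fintype.subset_trans AC); apply: subsetUr.
Qed.

Lemma Gamma_sub_le (A : {set V}) (L : R) :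
  (Gamma (indE E A) (hF E h A) <= L%:E)%E <->
  reach (tilt E h) (tilt E h (~: A) + L) (~: A) setT.
Proof.
rewrite Gamma_le; split.
  move=> /reach_sub; congr (reach _ _ _ _); apply/setP=> x; rewrite !inE.
  case: (boolP (x \in A)) => xA; rewrite ?orbT// orbF.
  by apply/imsetP; exists (exist _ x xA); rewrite ?inE.
move=> /sub_reach; congr (reach _ _ _ _); apply/setP=> x; rewrite !inE.
by [].
Qed.

(** The starting set [B] is the complement of the vertex set of the subgraph, so nonempty subgraphs
    correspond to proper starting sets. *)
Lemma Gamma_star_le (L : R) : (Gamma_star E h <= L%:E)%E <->
  forall B, B != setT -> reach (tilt E h) (tilt E h B + L) B setT.
Proof.
split.
  move=> /bigmax_leP[_ GL] B BT; rewrite -[B]setCK; apply/Gamma_sub_le/GL.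
  by apply: contraNneq BT => /(congr1 (@setC _)); rewrite setCK setC0 => ->.
move=> H; apply/bigmax_leP; split=> [|A A0]; first exact: leNye.
apply/Gamma_sub_le/H; apply: contraNneq A0 => /(congr1 (@setC _)).
by rewrite setCK setCT => ->.
Qed.

(* Replacing [B] by a minimiser of the energy among its subsets can only raise
   the barrier: joining [B] to a path issued from that minimiser costs at most
   the difference of the initial energies. *)
Lemma reach_from_min (B : {set V}) (L : R) : ~ reach (tilt E h) (tilt E h B + L) B setT ->
  exists A : {set V}, [/\ A \subset B, ~ reach (tilt E h) (tilt E h A + L) A setT &
    forall A' : {set V}, A' \subset A -> tilt E h A <= tilt E h A'].
Proof.
move=> nB.
case: (@arg_minP _ _ _ B (fun A : {set V} => A \subset B) (tilt E h) (fintype.subxx B)).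
move=> A AB minA; exists A; split=> // [rA|A' A'A]; last first.
  by apply: minA; apply: fintype.subset_trans AB.
apply: nB; suff: forall C, reach (tilt E h) (tilt E h A + L) A C ->
    reach (tilt E h) (tilt E h B + L) B (C :|: B).
  by move=> /(_ _ rA); rewrite setTU.
have sub (C : {set V}) : A \subset C -> tilt E h (C :|: B) <= tilt E h C + tilt E h B - tilt E h A.
  move=> AC; have := tilt_submodular E h C B.
  by have := minA _ (subsetIr C B); lra.
move=> C; elim=> [tA|{}C i rC IH iC ti].
  by rewrite (setUidPr AB); apply: reach_start; lra.
rewrite -setUA; apply: reach_add IH _; rewrite setUA.
have := sub (i |: C) (fintype.subset_trans (reach_sup rC) (subsetUr _ _)).
lra.
Qed.

End Subgraph.

(** * The heat-bath operator and its Dirichlet form *)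

Section Heat_bath.
Variables (R : realType) (V : finType) (m : config V -> R).
Hypothesis m_gt0 : forall x, 0 < m x.
Hypothesis V_gt0 : (0 < #|V|)%N.
Implicit Types (x : config V) (i : V) (s : bool) (u g : config V -> R).

Lemma upd_same x i s : upd x i s i = s.
Proof. by rewrite ffunE eqxx. Qed.

Lemma upd_upd x i s s' : upd (upd x i s) i s' = upd x i s'.
Proof. by apply/ffunP=> j; rewrite !ffunE; case: eqP. Qed.

Lemma upd_id x i s : x i = s -> upd x i s = x.
Proof. by move=> <-; apply/ffunP=> j; rewrite !ffunE; case: eqP => [->|]. Qed.

(** Configurations are grouped in pairs differing only at [i], each pair represented by its member
    with spin minus there. Claims on a single update become two-point computations. *)
Lemma sum_site i (F : config V -> R) :
  \sum_x F x = \sum_(x : config V | ~~ x i) (F (upd x i true) + F (upd x i false)).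
Proof.
rewrite (bigID (fun x : config V => x i)) /= big_split /=; congr (_ + _).
  rewrite (reindex_onto (fun x => upd x i true) (fun x => upd x i false)).
    apply: eq_bigl => x; rewrite upd_same upd_upd /=.
    apply/eqP/idP => [<-|/negbTE xi]; first by rewrite upd_same.
    exact: upd_id.
  by move=> x xi; rewrite upd_upd upd_id.
by apply: eq_bigr => x /negbTE xi; rewrite upd_id.
Qed.

(** The law of the spin at [i] under [m], conditioned on the other spins. Accordingly [site i] is a
    conditional expectation, an orthogonal projection in the L^2 space of [m]. *)
Definition gibbs x i s := m (upd x i s) / (m (upd x i true) + m (upd x i false)).
Definition site i u x := \sum_(s : bool) gibbs x i s * u (upd x i s).
Definition step u x := (#|V|%:R)^-1 * \sum_i site i u x.
Definition norm2 u := \sum_x m x * u x ^+ 2.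
(** The quadratic form of the sum over [i] of the projections [1 - site i], without the factor
    [1 / #|V|] of [step]. Each edge of the cube is counted once. *)
Definition dirichlet u := \sum_i \sum_(x : config V | ~~ x i)
  m (upd x i true) * m (upd x i false) / (m (upd x i true) + m (upd x i false)) *
  (u (upd x i true) - u (upd x i false)) ^+ 2.

Let n_gt0 : 0 < #|V|%:R :> R.
Proof. by rewrite ltr0n. Qed.

Lemma gibbs_ge0 x i s : 0 <= gibbs x i s.
Proof. by rewrite /gibbs divr_ge0 ?addr_ge0 ?ltW. Qed.

Lemma siteE i u x : site i u x =
  (m (upd x i true) * u (upd x i true) + m (upd x i false) * u (upd x i false)) /
  (m (upd x i true) + m (upd x i false)).
Proof. by rewrite /site big_bool /= /gibbs mulrDl; congr (_ + _); rewrite mulrAC. Qed.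

Lemma site_upd i u x s : site i u (upd x i s) = site i u x.
Proof. by rewrite !siteE !upd_upd. Qed.

Lemma site_cst i x : site i (fun=> 1) x = 1.
Proof. by rewrite siteE !mulr1 divff// gt_eqF// addr_gt0. Qed.

Lemma step_cst x : step (fun=> 1) x = 1.
Proof.
rewrite /step (eq_bigr (fun=> 1)); last by move=> i _; rewrite site_cst.
by rewrite sumr_const mulVf// gt_eqF.
Qed.

Lemma site_le i u g x : (forall y, u y <= g y) -> site i u x <= site i g x.
Proof. by move=> ug; apply: ler_sum => s _; apply: ler_wpM2l; rewrite ?gibbs_ge0. Qed.

Lemma step_le u g x : (forall y, u y <= g y) -> step u x <= step g x.
Proof.
move=> ug; apply: ler_wpM2l; first by rewrite invr_ge0 ltW.
by apply: ler_sum => i _; apply: site_le.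
Qed.

Lemma stepD u g x : step (fun y => u y + g y) x = step u x + step g x.
Proof.
rewrite /step -mulrDr -big_split; congr (_ * _); apply: eq_bigr => i _.
by rewrite !siteE /=; ring.
Qed.

Lemma stepN u x : step (fun y => - u y) x = - step u x.
Proof.
rewrite /step -mulrN -sumrN; congr (_ * _); apply: eq_bigr => i _.
by rewrite !siteE /=; ring.
Qed.

Lemma mean_const (c : R) : (#|V|%:R)^-1 * \sum_(i : V) c = c.
Proof. by rewrite sumr_const -(mulr_natl c) mulKf// gt_eqF. Qed.

Lemma step_invariant u : \sum_x m x * step u x = \sum_x m x * u x.
Proof.
rewrite -[RHS]mean_const /step; under eq_bigr do rewrite mulrCA.
rewrite -mulr_sumr; congr (_ * _); under eq_bigr do rewrite mulr_sumr.
rewrite exchange_big; apply: eq_bigr => i _ /=.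
rewrite [LHS](sum_site i) [RHS](sum_site i); apply: eq_bigr => x _.
rewrite !site_upd siteE; field.
by rewrite gt_eqF// addr_gt0.
Qed.

(** Pythagoras for the projection [site i]: the loss on each pair is its total weight times the
    variance of a two-point law. *)
Lemma site_norm2 i u : \sum_x m x * site i u x ^+ 2 = norm2 u -
  \sum_(x : config V | ~~ x i) m (upd x i true) * m (upd x i false) /
     (m (upd x i true) + m (upd x i false)) *
     (u (upd x i true) - u (upd x i false)) ^+ 2.
Proof.
rewrite /norm2 [LHS](sum_site i) [X in _ = X - _](sum_site i) -sumrN -big_split.
apply: eq_bigr => x _ /=; rewrite !site_upd siteE; field.
by rewrite gt_eqF// addr_gt0.
Qed.

Lemma sqr_mean_le (a : V -> R) :
  ((#|V|%:R)^-1 * \sum_i a i) ^+ 2 <= (#|V|%:R)^-1 * \sum_i a i ^+ 2.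
Proof.
set c := (X in X ^+ 2 <= _).
have : 0 <= (#|V|%:R)^-1 * \sum_i (a i - c) ^+ 2.
  by rewrite mulr_ge0 ?invr_ge0 ?(ltW n_gt0)// sumr_ge0// => i _; rewrite sqr_ge0.
under eq_bigr => i _.
  rewrite (_ : _ ^+ 2 = a i ^+ 2 + (- (2 * c)) * a i + c ^+ 2); last by ring.
  over.
rewrite !big_split !mulrDr mean_const -mulr_sumr mulrCA -/c /=; lra.
Qed.

(** [step] is an average of projections: convexity of the square bounds its squared norm by the
    average of theirs, which Pythagoras evaluates. *)
Lemma step_contracts u : norm2 (step u) <= norm2 u - (#|V|%:R)^-1 * dirichlet u.
Proof.
rewrite -{1}[norm2 u]mean_const -mulrBr -sumrB.
under [X in _ <= _ * X]eq_bigr => i _ do rewrite -site_norm2.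
rewrite exchange_big mulr_sumr; apply: ler_sum => x _ /=.
by rewrite -mulr_sumr [leRHS]mulrCA; apply: ler_wpM2l; rewrite ?(ltW (m_gt0 x))// sqr_mean_le.
Qed.

Lemma dirichlet_edge u x i :
  m (upd x i true) * m (upd x i false) / (m (upd x i true) + m (upd x i false)) *
     (u (upd x i true) - u (upd x i false)) ^+ 2 <= dirichlet u.
Proof.
have pos y j : 0 <= m (upd y j true) * m (upd y j false) /
    (m (upd y j true) + m (upd y j false)) * (u (upd y j true) - u (upd y j false)) ^+ 2.
  by rewrite mulr_ge0 ?sqr_ge0// divr_ge0 ?mulr_ge0 ?addr_ge0 ?(ltW (m_gt0 _)).
rewrite /dirichlet (bigD1 i)//= (bigD1 (upd x i false)) /=; last by rewrite upd_same.
rewrite !upd_upd -addrA lerDl addr_ge0// sumr_ge0// => j _; rewrite ?pos//.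
by apply: sumr_ge0 => y _; apply: pos.
Qed.

End Heat_bath.

(** * The chain killed at the all-plus configuration *)

Section Killed_chain.
Variables (R : realType) (V : finType) (m : config V -> R) (sd : nat -> config V -> R).
Hypothesis m_gt0 : forall x, 0 < m x.
Hypothesis V_gt0 : (0 < #|V|)%N.
Hypothesis sd0 : forall x, sd 0 x = (x != allplus V)%:R.
Hypothesis sdS : forall k x,
  sd k.+1 x = if x == allplus V then 0 else step m (sd k) x.

Lemma sd_ge0_le1 k x : 0 <= sd k x <= 1.
Proof.
elim: k x => [|k IH] x; first by rewrite sd0; case: eqP; rewrite lexx ler01.
rewrite sdS; case: eqP => _; first by rewrite lexx ler01.
rewrite -[X in _ && (_ <= X)](step_cst m_gt0 V_gt0 x) step_le//; last by move=> y; case/andP: (IH y).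
rewrite andbT mulr_ge0 ?invr_ge0// sumr_ge0// => i _; rewrite sumr_ge0// => s _.
by rewrite mulr_ge0 ?gibbs_ge0//; case/andP: (IH (upd x i s)).
Qed.

(** All-plus lies outside [Om] and can be hit only by leaving it. In a first-step analysis,
    invariance of [m] bounds the part that stays inside by the previous sum; the rest is the
    one-step flow out of [Om]. *)
Lemma escape_le (Om : {set config V}) (q : R) : 0 <= q -> allplus V \notin Om ->
  (forall x i s, x \in Om -> upd x i s \notin Om -> m x * gibbs m x i s <= q) ->
  forall k, \sum_(x in Om) m x * (1 - sd k x) <= k%:R * (2 * #|{: config V}|%:R * q).
Proof.
move=> q0 Omp exitq; elim=> [|k IH].
  rewrite mul0r big1// => x xO; rewrite sd0 (_ : x != _) ?subrr ?mulr0//.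
  by apply: contraNneq Omp => <-.
pose inside y : R := (y \in Om)%:R * (1 - sd k y).
pose outside y : R := (y \notin Om)%:R.
have stepE x : x \in Om -> 1 - sd k.+1 x <= step m inside x + step m outside x.
  move=> xO; rewrite sdS ifN; last by apply: contraNneq Omp => <-.
  rewrite -[X in X - _](step_cst m_gt0 V_gt0 x) -stepN -!stepD; apply: step_le => // y.
  rewrite /inside /outside; case: (y \in Om) => /=; first by lra.
  by have := sd_ge0_le1 k y; lra.
have inE : \sum_(x in Om) m x * step m inside x <= \sum_(x in Om) m x * (1 - sd k x).
  have -> : \sum_(x in Om) m x * (1 - sd k x) = \sum_x m x * inside x.
    rewrite big_mkcond; apply: eq_bigr => x _; rewrite /inside.
    by case: (x \in Om); rewrite ?mul1r// mul0r mulr0.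
  rewrite -step_invariant// [leRHS](bigID (fun x => x \in Om)) /= lerDl.
  apply: sumr_ge0 => x _; rewrite mulr_ge0 ?(ltW (m_gt0 x))//.
  rewrite mulr_ge0 ?invr_ge0// sumr_ge0// => i _; rewrite sumr_ge0// => s _.
  rewrite mulr_ge0 ?gibbs_ge0// mulr_ge0//.
  by have := sd_ge0_le1 k (upd x i s); lra.
(* Averaging over sites leaves one [q] per spin value, hence the 2; the size of [Om] is bounded by
   the number of configurations. *)
have outE : \sum_(x in Om) m x * step m outside x <= 2 * #|{: config V}|%:R * q.
  apply: (@le_trans _ _ (\sum_(x : config V) 2 * q)); last first.
    by rewrite sumr_const -(mulr_natl (2 * q)) mulrA (mulrC _ 2).
  apply: (@le_trans _ _ (\sum_(x in Om) 2 * q)); last first.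
    rewrite [leRHS](bigID (fun x => x \in Om)) /= lerDl sumr_ge0// => x _.
    by rewrite mulr_ge0.
  apply: ler_sum => x xO; rewrite -[leRHS](mean_const V_gt0) /step mulrCA.
  apply: ler_wpM2l; first by rewrite invr_ge0.
  rewrite mulr_sumr; apply: ler_sum => i _; rewrite mulr_sumr big_bool /=.
  have one s : m x * (gibbs m x i s * outside (upd x i s)) <= q.
    rewrite mulrA /outside; case: (boolP (upd x i s \in Om)) => yO /=; first by rewrite mulr0.
    by rewrite mulr1; apply: exitq.
  by have := one true; have := one false; lra.
have -> : k.+1%:R = k%:R + 1 :> R by rewrite natr1.
rewrite [leRHS]mulrDl mul1r; apply: le_trans (lerD IH outE).
apply: le_trans (lerD inE (lexx _)); rewrite -big_split; apply: ler_sum => x xO /=.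
by rewrite -mulrDr; apply: ler_wpM2l; rewrite ?(ltW (m_gt0 x))// stepE.
Qed.

(* Being a mean of conditional expectations, the heat-bath operator satisfies
   [P ^ 2 <= P] in L^2, so a spectral gap controls discrete time directly,
   without a lazy version of the chain. *)
Lemma decay (lam : R) :
  (forall u, u (allplus V) = 0 -> lam * norm2 m u <= (#|V|%:R)^-1 * dirichlet m u) ->
  forall k, norm2 m (sd k) <= expR (- lam * k%:R) * \sum_x m x.
Proof.
move=> gap; elim=> [|k IH].
  rewrite mulr0 expR0 mul1r; apply: ler_sum => x _; rewrite ler_piMr ?(ltW (m_gt0 x))//.
  by rewrite sd0; case: eqP; rewrite ?expr0n ?expr1n.
have n0 : 0 <= norm2 m (sd k).
  by apply: sumr_ge0 => x _; rewrite mulr_ge0 ?sqr_ge0 ?(ltW (m_gt0 x)).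
have sdp : sd k (allplus V) = 0 by case: (k) => [|j]; rewrite ?sd0 ?sdS eqxx.
have le1 : norm2 m (sd k.+1) <= norm2 m (step m (sd k)).
  apply: ler_sum => x _; apply: ler_wpM2l; first exact: ltW.
  by rewrite sdS; case: eqP => _; rewrite ?expr0n ?sqr_ge0.
have le2 := step_contracts m_gt0 V_gt0 (sd k).
have le3 := gap _ sdp.
have le4 : norm2 m (sd k.+1) <= expR (- lam) * norm2 m (sd k).
  apply: (@le_trans _ _ ((1 - lam) * norm2 m (sd k))); first by lra.
  by apply: ler_wpM2r => //; apply: expR_ge1Dx.
apply: (le_trans le4).
rewrite -natr1 mulrDr mulr1 addrC expRD -mulrA.
by apply: ler_wpM2l IH; apply: expR_ge0.
Qed.

End Killed_chain.

(** * Means over a Poisson number of steps *)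

Section Poisson.
Variable R : realType.

Definition poisson_mean (a : R) (s : nat -> R) :=
  limn (fun N => \sum_(k < N) expR (- a) * a ^+ k / (k`!)%:R * s k).

Let ex (a : R) N : R := \sum_(k < N) a ^+ k / (k`!)%:R.

Let ex_cvg a : (ex a @ \oo --> expR a)%classic.
Proof.
rewrite (_ : ex a = series (exp_coeff a)); first exact: is_cvg_series_exp_coeff.
by apply/funext => N; rewrite /series /= big_mkord.
Qed.

Let term_ge0 (a : R) k : 0 <= a -> 0 <= a ^+ k / (k`!)%:R.
Proof. by move=> a0; rewrite divr_ge0 ?exprn_ge0. Qed.

Let weight_ge0 (a : R) k : 0 <= a -> 0 <= expR (- a) * a ^+ k / (k`!)%:R.
Proof. by move=> a0; rewrite divr_ge0 ?mulr_ge0 ?exprn_ge0 ?expR_ge0. Qed.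

Let ex_le (a : R) N : 0 <= a -> ex a N <= expR a.
Proof.
move=> a0; rewrite -(cvg_lim _ (@ex_cvg a))//; apply: nondecreasing_cvgn_le.
  apply/nondecreasing_seqP => n; rewrite /ex big_ord_recr /= lerDl; exact: term_ge0.
by apply/cvg_ex; exists (expR a); apply: ex_cvg.
Qed.

Let is_cvg_poisson (a : R) (s : nat -> R) : 0 <= a -> (forall k, 0 <= s k <= 1) ->
  cvgn (fun N => \sum_(k < N) expR (- a) * a ^+ k / (k`!)%:R * s k).
Proof.
move=> a0 s01; apply: nondecreasing_is_cvgn.
  apply/nondecreasing_seqP => n; rewrite big_ord_recr /= lerDl.
  by apply: mulr_ge0; [exact: weight_ge0 | case/andP: (s01 n)].
exists 1 => _ [N _ <-].
apply: (@le_trans _ _ (expR (- a) * ex a N)).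
  rewrite mulr_sumr; apply: ler_sum => k _; rewrite mulrA ler_piMr ?weight_ge0//.
  by case/andP: (s01 k).
rewrite -[leRHS](expR0) -(addNr a) expRD; apply: ler_wpM2l; first exact: expR_ge0.
exact: ex_le.
Qed.

(** This is the generating function of the Poisson law, evaluated at [r]. *)
Lemma poisson_mean_le (a A r : R) (s : nat -> R) : 0 <= a -> 0 <= A -> 0 <= r ->
  (forall k, 0 <= s k <= 1) -> (forall k, s k <= A * r ^+ k) ->
  poisson_mean a s <= A * expR (- (a * (1 - r))).
Proof.
move=> a0 A0 r0 s01 sA; apply: limr_le; first exact: is_cvg_poisson.
apply: nearW => N; apply: (@le_trans _ _ (A * (expR (- a) * ex (a * r) N))).
  rewrite !mulr_sumr; apply: ler_sum => k _.
  apply: (@le_trans _ _ (expR (- a) * a ^+ k / (k`!)%:R * (A * r ^+ k))).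
    by apply: ler_wpM2l => //; apply: weight_ge0.
  by rewrite exprMn le_eqVlt; apply/orP; left; apply/eqP; ring.
apply: ler_wpM2l => //; rewrite (_ : - (a * (1 - r)) = - a + a * r); last by ring.
rewrite expRD; apply: ler_wpM2l; first exact: expR_ge0.
by apply: ex_le; rewrite mulr_ge0.
Qed.

(** The Poisson law has mean [a]. On partial sums, shifting the index bounds the truncated first
    moment by [a] times the truncated mass, which is enough in the limit. *)
Lemma poisson_mean_ge (a del : R) (s : nat -> R) : 0 <= a -> 0 <= del ->
  (forall k, 0 <= s k <= 1) -> (forall k, 1 - k%:R * del <= s k) ->
  1 - a * del <= poisson_mean a s.
Proof.
move=> a0 d0 s01 sd.
have first_moment N : \sum_(k < N) a ^+ k / (k`!)%:R * k%:R <= a * ex a N.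
  case: N => [|N]; first by rewrite big_ord0 /ex big_ord0 mulr0.
  rewrite big_ord_recl /= mulr0 add0r /ex big_ord_recr /= mulrDr.
  apply: (@le_trans _ _ (a * \sum_(k < N) a ^+ k / (k`!)%:R)); last first.
    by rewrite lerDl mulr_ge0 ?term_ge0.
  rewrite mulr_sumr; apply: ler_sum => k _.
  rewrite /bump /= add1n factS natrM exprS le_eqVlt; apply/orP; left; apply/eqP.
  have : k.+1%:R != 0 :> R by rewrite pnatr_eq0.
  have : (k`!)%:R != 0 :> R by rewrite pnatr_eq0 -lt0n fact_gt0.
  move: (k`!)%:R k.+1%:R => d c dn0 cn0; field; exact/andP.
have lim : (expR (- a) * ((1 - a * del) * ex a N) @[N --> \oo] -->
    expR (- a) * ((1 - a * del) * expR a))%classic.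
  by apply: cvgM; [exact: cvg_cst | apply: cvgM; [exact: cvg_cst | exact: ex_cvg]].
have -> : 1 - a * del = expR (- a) * ((1 - a * del) * expR a).
  by rewrite mulrCA -expRD addNr expR0 mulr1.
rewrite -(cvg_lim _ lim)//; apply: ler_lim.
- by apply/cvg_ex; exists (expR (- a) * ((1 - a * del) * expR a)).
- exact: is_cvg_poisson.
apply: nearW => N.
apply: (@le_trans _ _ (\sum_(k < N) expR (- a) * a ^+ k / (k`!)%:R * (1 - k%:R * del))).
  have -> : \sum_(k < N) expR (- a) * a ^+ k / (k`!)%:R * (1 - k%:R * del) =
     expR (- a) * (ex a N - del * \sum_(k < N) a ^+ k / (k`!)%:R * k%:R).
    rewrite mulr_sumr -sumrB mulr_sumr; apply: eq_bigr => k _; ring.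
  apply: ler_wpM2l; first exact: expR_ge0.
  by have := ler_wpM2l d0 (first_moment N); lra.
apply: ler_sum => k _; apply: ler_wpM2l => //; exact: weight_ge0.
Qed.

End Poisson.

Lemma reach_everywhere (R : realType) (T : finType) (f : {set T} -> R) L (B : {set T}) :
  (forall S, f S <= L) -> reach f L B setT.
Proof.
move=> fL; suff r (s : seq T) : reach f L B ([set x in s] :|: B).
  have -> : setT = [set x in enum T] :|: B by apply/setP=> x; rewrite !inE mem_enum.
  exact: r.
elim: s => [|i s IH].
  rewrite (_ : [set x in _] = set0) ?set0U; first exact: reach_start.
  by apply/setP=> x; rewrite !inE.
rewrite (_ : [set x in _] :|: _ = i |: ([set x in s] :|: B)); first exact: reach_add.
by apply/setP=> x; rewrite !inE orbA.
Qed.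

(** * Bounds on the survival probability of the Glauber dynamics *)

Section Glauber_weights.
Variables (R : realType) (V : finType) (E : rel V) (h : V -> R) (beta : R).
Hypotheses (Esym : symmetric E) (Eirr : irreflexive E) (beta_ge0 : 0 <= beta).
Hypothesis V_gt0 : (0 < #|V|)%N.
Local Notation f := (tilt E h).
Local Notation n := (#|V|%:R : R).
Local Notation N := (#|{: config V}|%:R : R).

Definition plus_set (x : config V) : {set V} := [set i | x i].
Definition config_of (S : {set V}) : config V := [ffun i => i \in S].
Definition weight (x : config V) : R := expR (- (2 * beta * f (plus_set x))).

Lemma weight_gt0 x : 0 < weight x. Proof. exact: expR_gt0. Qed.

Lemma config_ofK S : plus_set (config_of S) = S.
Proof. by apply/setP=> i; rewrite !inE ffunE. Qed.

Lemma plus_setK x : config_of (plus_set x) = x.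
Proof. by apply/ffunP=> i; rewrite !ffunE inE. Qed.

Lemma plus_set_true x i : plus_set (upd x i true) = i |: plus_set x.
Proof. by apply/setP=> j; rewrite !inE ffunE; case: eqP. Qed.

Lemma plus_set_false x i : plus_set (upd x i false) = plus_set x :\ i.
Proof. by apply/setP=> j; rewrite !inE ffunE; case: eqP. Qed.

(** Adding [i] creates a cut edge to each minus neighbour and removes one to each plus neighbour.
    Symmetry of [E] converts the edges entering [i]; irreflexivity rules out a loop at [i]. *)
Lemma tiltU1 (S : {set V}) i : i \notin S ->
  f (i |: S) = f S - (h i + \sum_(j | E i j) spin R (j \in S)).
Proof.
move=> iS; rewrite !tiltE.
pose s x : R := (x \in S)%:R; pose d x : R := (x == i)%:R; pose e x y : R := (E x y)%:R.
have sU x : (x \in i |: S)%:R = s x + d x.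
  rewrite /s /d !inE; case: eqP => [->|_] /=; last by rewrite addr0.
  by rewrite (negbTE iS) add0r.
have pick (F : V -> R) : \sum_x d x * F x = F i.
  rewrite (bigD1 i)//= /d eqxx mul1r big1 ?addr0// => x /negbTE ->.
  by rewrite mul0r.
have -> : \sum_(j | E i j) spin R (j \in S) = \sum_x (e i x * s x - e i x * (1 - s x)).
  rewrite big_mkcond; apply: eq_bigr => x _; rewrite /e /s /spin.
  by case: (E i x); case: (x \in S) => /=; ring.
have -> : \sum_x (x \in i |: S)%:R * h x = \sum_x s x * h x + h i.
  rewrite -(pick h) -big_split; apply: eq_bigr => x _ /=.
  by rewrite sU mulrDl.
have -> : \sum_x \sum_y e x y * (x \in i |: S)%:R * (1 - (y \in i |: S)%:R) =
    \sum_x \sum_y e x y * s x * (1 - s y)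
    + \sum_x d x * \sum_y e x y * (1 - s y)
    - \sum_x \sum_y d y * (e x y * s x) - \sum_x d x * \sum_y d y * e x y.
  rewrite -big_split -!sumrB; apply: eq_bigr => x _ /=.
  rewrite !mulr_sumr -big_split -!sumrB; apply: eq_bigr => y _ /=.
  by rewrite !sU; ring.
have -> : \sum_x \sum_y d y * (e x y * s x) = \sum_x e i x * s x.
  by apply: eq_bigr => x _; rewrite pick /e Esym.
have eii : e i i = 0 by rewrite /e Eirr.
by rewrite !pick eii sumrB; ring.
Qed.

Lemma KfieldE x i : Kfield E h x i =
  h i + \sum_(j | E i j) spin R (j \in plus_set x :\ i).
Proof.
congr (_ + _); apply: eq_bigr => j Eij; rewrite !inE.
by case: eqP => // ji; rewrite ji Eirr in Eij.
Qed.

(** Flipping the spin at [i] changes [f] by the local field, so the exponential in [hb_prob] is the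
    ratio of the two weights. *)
Lemma hb_probE x i s : hb_prob E h beta x i s = gibbs weight x i s.
Proof.
have c : expR (- (2 * beta * Kfield E h x i * spin R s)) * weight (upd x i s) =
    weight (upd x i (~~ s)).
  have fE : f (i |: plus_set x) = f (plus_set x :\ i) - Kfield E h x i.
    rewrite KfieldE -tiltU1 ?setD11//; congr f.
    by apply/setP=> j; rewrite !inE; case: eqP.
  rewrite /weight -expRD; congr expR; case: s => /=;
    rewrite plus_set_true plus_set_false fE; ring.
have wE : weight (upd x i true) + weight (upd x i false) =
    weight (upd x i s) + weight (upd x i (~~ s)) by case: s {c} => //=; rewrite addrC.
rewrite /hb_prob /gibbs wE -c.
set e := expR _; have e0 : 0 < e by apply: expR_gt0.
have w0 := weight_gt0 (upd x i s); field.
by rewrite !gt_eqF// ?addr_gt0 ?mulr_gt0.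
Qed.

Lemma surv_disc0 x : surv_disc E h beta 0 x = (x != allplus V)%:R.
Proof. by rewrite /=; case: eqP. Qed.

Lemma surv_discS k x : surv_disc E h beta k.+1 x =
  if x == allplus V then 0 else step weight (surv_disc E h beta k) x.
Proof.
rewrite /=; case: eqP => // _; congr (_ * _); apply: eq_bigr => i _.
by apply: eq_bigr => s _; rewrite hb_probE.
Qed.

Lemma plus_set_allplus : plus_set (allplus V) = setT.
Proof. by apply/setP=> i; rewrite !inE ffunE. Qed.

Let n_ge1 : 1 <= n. Proof. by rewrite ler1n. Qed.

Let N_ge1 : 1 <= N.
Proof. by rewrite ler1n; apply/card_gt0P; exists (allplus V). Qed.

Lemma survE x t : t != 0 ->
  surv E h beta x t = poisson_mean (n * t) (fun k => surv_disc E h beta k x).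
Proof. by rewrite /surv => /negbTE ->. Qed.

Lemma surv_lower (L : R) (B : {set V}) : B != setT ->
  ~ reach f (f B + L) B setT ->
  (forall A : {set V}, A \subset B -> f B <= f A) ->
  forall t, 0 <= t -> surv E h beta (config_of B) t <= expR (- 1) ->
  expR (2 * beta * L) <= 4 * n * N * t.
Proof.
move=> BT nr minB t t0.
have e12 : expR (- 1) <= 2^-1 :> R.
  rewrite expRN lef_pV2 ?posrE ?expR_gt0//.
  by have := expR_ge1Dx (1 : R); lra.
(* At time 0 [surv] is 1 by definition, so the assumption on [surv] fails. *)
have [->|tn0] := eqVneq t 0; first by rewrite /surv eqxx; lra.
rewrite survE// => surv1.
have [Om [BOm OmT Omd OmU Omb]] := reach_cut (tilt_submodular E h) BT nr.
pose OmC := [set x : config V | plus_set x \in Om].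
pose q := expR (- (2 * beta * (f B + L))).
have join (S : {set V}) : f (S :|: B) <= f S.
  have := tilt_submodular E h S B; have := minB _ (subsetIr S B); lra.
have wq x : f B + L <= f (plus_set x) -> weight x <= q.
  move=> fx; rewrite /weight /q ler_expR lerN2; apply: ler_wpM2l => //.
  by rewrite mulr_ge0.
have exitq x i s : x \in OmC -> upd x i s \notin OmC -> weight x * gibbs weight x i s <= q.
  rewrite !inE => xOm; case: s; last first.
    rewrite plus_set_false => /negP[]; apply: Omd xOm _; exact: subsetDl.
  move=> yOm; have xi : x i = false.
    by apply: contraNF yOm => xi; rewrite upd_id.
  rewrite /gibbs (_ : weight x = weight (upd x i false)); last by rewrite upd_id.
  have wx := weight_gt0 (upd x i false); have wy := weight_gt0 (upd x i true).
  set a := weight (upd x i false) in wx *; set b := weight (upd x i true) in wy *.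
  have ab : 0 < b + a by rewrite addr_gt0.
  rewrite mulrA ler_pdivrMr//.
  rewrite plus_set_true in yOm.
  have yOm' : i |: (plus_set x :|: B) \notin Om.
    by apply: contraNN yOm => H; apply: Omd H _; rewrite setUA subsetUl.
  have q0 : 0 <= q by apply: expR_ge0.
  (* The flow [a * b / (b + a)] is at most the smaller weight, so one end above the barrier
     suffices. The bound from [Omb] holds for the pair joined with [B], and [join] carries it back
     to the original pair. *)
  have [fS|fS] := Omb _ i (subsetUr _ _) (OmU _ xOm) yOm'.
    have : a <= q.
      by apply: wq; rewrite upd_id//; apply: le_trans (ltW fS) _; apply: join.
    move=> aq; have := ler_wpM2r (ltW wy) aq; have := mulr_ge0 q0 (ltW wx). lra.
  have : b <= q.
    apply: wq; rewrite plus_set_true; apply: le_trans (ltW fS) _.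
    by rewrite setUA; apply: join.
  move=> bq; have := ler_wpM2r (ltW wx) bq; have := mulr_ge0 q0 (ltW wy); lra.
have plusOm : allplus V \notin OmC by rewrite inE plus_set_allplus.
have esc := escape_le weight_gt0 V_gt0 surv_disc0 surv_discS (expR_ge0 _) plusOm exitq.
have sd01 := sd_ge0_le1 weight_gt0 V_gt0 surv_disc0 surv_discS.
(* The escape bound per step, divided by the weight of [config_of B]. *)
pose del := 2 * N * expR (- (2 * beta * L)).
have del0 : 0 <= del by rewrite mulr_ge0 ?expR_ge0 ?mulr_ge0.
have sdge k : 1 - k%:R * del <= surv_disc E h beta k (config_of B).
  have wB := weight_gt0 (config_of B).
  have qE : q = weight (config_of B) * expR (- (2 * beta * L)).
    by rewrite /q /weight config_ofK -expRD; congr expR; ring.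
  have : weight (config_of B) * (1 - surv_disc E h beta k (config_of B)) <=
      weight (config_of B) * (k%:R * del).
    apply: le_trans (_ : k%:R * (2 * N * q) <= _); last by rewrite qE /del; lra.
    apply: le_trans (esc k); rewrite (bigD1 (config_of B)) /=; last by rewrite inE config_ofK.
    rewrite lerDl sumr_ge0// => x _; rewrite mulr_ge0 ?(ltW (weight_gt0 _))//.
    by have := sd01 k x; lra.
  by rewrite ler_pM2l//; lra.
have a0 : 0 <= n * t by rewrite mulr_ge0.
have low := poisson_mean_ge a0 del0 (fun k => sd01 k _) sdge.
have ele : 1 <= 2 * (n * t * del) by lra.
have eE : expR (2 * beta * L) * expR (- (2 * beta * L)) = 1 by rewrite -expRD addrN expR0.
have := ler_wpM2l (expR_ge0 (2 * beta * L)) ele.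
have -> : expR (2 * beta * L) * (2 * (n * t * del)) =
   4 * n * N * t * (expR (2 * beta * L) * expR (- (2 * beta * L))) by rewrite /del; ring.
by rewrite eE !mulr1.
Qed.

(** Since [u] vanishes at all-plus, [u x] telescopes along an increasing path of at most [n] edges,
    hence [n ^+ 2] after squaring; the factor [N] comes from summing over [x]. *)
Lemma poincare (g : R) : (forall B, B != setT -> reach f (f B + g) B setT) ->
  forall u, u (allplus V) = 0 ->
  norm2 weight u <= N * (2 * n ^+ 2 * expR (2 * beta * g)) * dirichlet weight u.
Proof.
move=> rg u u0.
set D := dirichlet weight u.
have D0 : 0 <= D.
  by apply: le_trans (dirichlet_edge weight_gt0 u (allplus V) (enum_val (Ordinal V_gt0)));
    rewrite mulr_ge0 ?sqr_ge0// divr_ge0 ?mulr_ge0 ?addr_ge0 ?(ltW (weight_gt0 _)).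
have along L B C : reach f L B C ->
    `|u (config_of C) - u (config_of B)| <= #|C|%:R * Num.sqrt (2 * D * expR (2 * beta * L)).
  set w := Num.sqrt _; have w0 : 0 <= w by apply: sqrtr_ge0.
  elim=> [_|{}C i rC IH iC fi]; first by rewrite subrr normr0 mulr_ge0.
  rewrite cardsU1 iC add1n -natr1 mulrDl mul1r.
  have -> : u (config_of (i |: C)) - u (config_of B) =
    (u (config_of C) - u (config_of B)) + (u (config_of (i |: C)) - u (config_of C)) by ring.
  apply: le_trans (ler_normD _ _) _; apply: lerD => //.
  rewrite -sqrtr_sqr ler_wsqrtr//.
  have := dirichlet_edge weight_gt0 u (config_of C) i.
  have -> : upd (config_of C) i true = config_of (i |: C).
    by rewrite -[LHS]plus_setK plus_set_true config_ofK.
  have -> : upd (config_of C) i false = config_of C.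
    by apply: upd_id; rewrite ffunE (negbTE iC).
  set a := weight (config_of (i |: C)); set b := weight (config_of C); set z := (_ - _) ^+ 2.
  have z0 : 0 <= z by apply: sqr_ge0.
  pose c := expR (- (2 * beta * L)).
  have lew S : f S <= L -> c <= weight (config_of S).
    move=> fS; rewrite /weight config_ofK ler_expR lerN2; apply: ler_wpM2l => //.
    by rewrite mulr_ge0.
  have c0 : 0 < c by apply: expR_gt0.
  have ca : c <= a by apply: lew.
  have cb : c <= b by apply: lew; apply: reach_le rC.
  have ab : 0 < a + b by lra.
  (* Both ends of the edge have weight at least [c], so its conductance is at least that of two
     equal weights [c]. *)
  have half : c / 2 <= a * b / (a + b).
    rewrite ler_pdivlMr//.
    have := ler_wpM2r (_ : 0 <= a) cb; have := ler_wpM2l (_ : 0 <= b) ca.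
    by move=> /(_ ltac:(lra)) + /(_ ltac:(lra)); lra.
  move=> edge; have cz : c * z <= 2 * D.
    by have := ler_wpM2r z0 half; rewrite -/D in edge; lra.
  have cE : c * expR (2 * beta * L) = 1 by rewrite -expRD addNr expR0.
  have -> : z = c * z * expR (2 * beta * L) by rewrite mulrAC cE mul1r.
  by apply: ler_wpM2r => //; apply: expR_ge0.
have bound x : weight x * u x ^+ 2 <= 2 * n ^+ 2 * expR (2 * beta * g) * D.
  have rhs0 : 0 <= 2 * n ^+ 2 * expR (2 * beta * g) * D.
    by rewrite mulr_ge0// mulr_ge0 ?expR_ge0// mulr_ge0 ?sqr_ge0.
  have [xT|xT] := eqVneq (plus_set x) setT.
    have -> : x = allplus V by rewrite -(plus_setK x) xT -plus_set_allplus plus_setK.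
    by rewrite u0 expr0n mulr0.
  have := along _ _ _ (rg _ xT).
  rewrite plus_setK -plus_set_allplus plus_setK u0 sub0r normrN plus_set_allplus cardsT.
  set W := (2 * D * _) => ux.
  have W0 : 0 <= W by rewrite mulr_ge0 ?expR_ge0 ?mulr_ge0.
  have : u x ^+ 2 <= n ^+ 2 * W.
    rewrite -[W]sqr_sqrtr// -exprMn -real_normK ?num_real//.
    by rewrite ler_sqr ?nnegrE// mulr_ge0 ?sqrtr_ge0.
  move=> ux2; apply: le_trans (ler_wpM2l (ltW (weight_gt0 x)) ux2) _.
  rewrite le_eqVlt; apply/orP; left; apply/eqP.
  (* The weight of the starting point cancels the initial energy in the level of the path, leaving
     only the barrier [g]. *)
  have -> : expR (2 * beta * g) = weight x * expR (2 * beta * (f (plus_set x) + g)).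
    by rewrite /weight -expRD; congr expR; ring.
  by rewrite /W; ring.
apply: le_trans (_ : \sum_(x : config V) 2 * n ^+ 2 * expR (2 * beta * g) * D <= _).
  exact: ler_sum.
by rewrite sumr_const -(mulr_natl (2 * n ^+ 2 * expR _ * D)) mulrA.
Qed.

Lemma surv_upper (g C : R) : 0 <= g -> (forall S, `|f S| <= C) ->
  (forall B, B != setT -> reach f (f B + g) B setT) ->
  forall x, surv E h beta x (8 * n ^+ 2 * N * (1 + N + 2 * beta * C) * expR (2 * beta * g))
    <= expR (- 1).
Proof.
move=> g0 fC rg x; set t := (X in surv _ _ _ _ X).
have C0 : 0 <= C by apply: le_trans (fC set0).
have bC0 : 0 <= beta * C by rewrite mulr_ge0.
have bg0 : 0 <= beta * g by rewrite mulr_ge0.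
have n0 : 0 < n := lt_le_trans ltr01 n_ge1.
have N0 : 0 < N := lt_le_trans ltr01 N_ge1.
have c0 : 0 < 1 + N + 2 * beta * C by lra.
have t0 : 0 < t by rewrite !mulr_gt0 ?expR_gt0// exprn_gt0.
rewrite survE ?gt_eqF//.
pose K := N * (2 * n ^+ 2 * expR (2 * beta * g)).
have K1 : 1 <= K.
  have e1 : 1 <= expR (2 * beta * g) by apply: le_trans (expR_ge1Dx _); lra.
  have n21 : 1 <= 2 * n ^+ 2 by have := exprn_ege1 2 n_ge1; lra.
  by rewrite mulr_ege1// mulr_ege1.
have nK1 : 1 <= n * K by rewrite mulr_ege1.
have nK0 : 0 < n * K by lra.
pose lam := (n * K)^-1.
have lam0 : 0 < lam by rewrite invr_gt0.
have lam1 : lam <= 1 by rewrite invf_le1.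
have gap u : u (allplus V) = 0 -> lam * norm2 weight u <= n^-1 * dirichlet weight u.
  move=> u0; rewrite /lam invfM -mulrA; apply: ler_wpM2l; first by rewrite invr_ge0 ltW.
  by rewrite mulrC ler_pdivrMr; [rewrite mulrC; exact: poincare | lra].
have dec := decay weight_gt0 V_gt0 surv_disc0 surv_discS gap.
have sd01 := sd_ge0_le1 weight_gt0 V_gt0 surv_disc0 surv_discS.
(* The square root of the total weight over [weight x] is at most [A]: each weight lies between
   [expR (- (2 * beta * C))] and [expR (2 * beta * C)], and [N <= expR (2 * N)]. Likewise [r] is the
   square root of the decay factor of [norm2]. *)
pose A := expR (N + 2 * beta * C).
pose r := expR (- (lam / 2)).
have sdle k : surv_disc E h beta k x <= A * r ^+ k.
  have [sd0 _] := andP (sd01 k x).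
  rewrite -ler_sqr ?nnegrE ?mulr_ge0 ?exprn_ge0 ?expR_ge0//.
  have wle y : weight y <= expR (2 * beta * C).
    rewrite /weight ler_expR; have := fC (plus_set y); rewrite ler_norml => /andP[Cf _].
    by have := ler_wpM2l beta_ge0 Cf; lra.
  have wge : expR (- (2 * beta * C)) <= weight x.
    rewrite /weight ler_expR; have := fC (plus_set x); rewrite ler_norml => /andP[_ fC'].
    by have := ler_wpM2l beta_ge0 fC'; lra.
  have sumw : \sum_y weight y <= N * expR (2 * beta * C).
    apply: le_trans (_ : \sum_(y : config V) expR (2 * beta * C) <= _); first exact: ler_sum.
    by rewrite sumr_const -(mulr_natl (expR _)).
  have sum1 : weight x * surv_disc E h beta k x ^+ 2 <=
      expR (- lam * k%:R) * (N * expR (2 * beta * C)).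
    apply: le_trans (ler_wpM2l (expR_ge0 _) sumw).
    apply: le_trans (dec k); rewrite /norm2 (bigD1 x)//= lerDl sumr_ge0// => y _.
    by rewrite mulr_ge0 ?sqr_ge0 ?(ltW (weight_gt0 y)).
  have sq0 : 0 <= surv_disc E h beta k x ^+ 2 by apply: sqr_ge0.
  have sum2 := le_trans (ler_wpM2r sq0 wge) sum1.
  have NN : N <= expR (2 * N) by apply: le_trans (expR_ge1Dx _); lra.
  have := ler_wpM2l (expR_ge0 (2 * beta * C)) sum2.
  rewrite mulrA -expRD addrN expR0 mul1r => /le_trans; apply.
  apply: le_trans (_ : expR (2 * beta * C) * (expR (- lam * k%:R) *
       (expR (2 * N) * expR (2 * beta * C))) <= _).
    by do 2! (apply: ler_wpM2l; first exact: expR_ge0); apply: ler_wpM2r; rewrite ?expR_ge0.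
  rewrite /A /r -expRM_natl -!expRD expr2 -expRD ler_expR; lra.
have r0 : 0 <= r by apply: expR_ge0.
have a0 : 0 <= n * t by rewrite mulr_ge0 ?(ltW t0) ?(ltW n0).
apply: le_trans (poisson_mean_le a0 (expR_ge0 _) r0 (fun k => sd01 k x) sdle) _.
have r1 : lam / 4 <= 1 - r.
  rewrite /r expRN; have e1 := expR_ge1Dx (lam / 2).
  have : (expR (lam / 2))^-1 <= (1 + lam / 2)^-1.
    by rewrite lef_pV2 ?posrE ?expR_gt0//; lra.
  suff : (1 + lam / 2)^-1 <= 1 - lam / 4 by lra.
  by rewrite -[leLHS]mul1r ler_pdivrMr; [nra | lra].
rewrite /A -expRD ler_expR.
have : n * t * (lam / 4) <= n * t * (1 - r) by apply: ler_wpM2l.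
(* The time [t] is chosen for this identity: the exponent then beats that of [A] by exactly 1. *)
suff -> : n * t * (lam / 4) = 1 + N + 2 * beta * C by lra.
rewrite /t /lam /K; field.
by rewrite !gt_eqF ?expR_gt0.
Qed.

End Glauber_weights.

(** * Asymptotics of the hitting time *)

Theorem theorem1 (R : realType) (V : finType) (E : rel V) (h : V -> R) :
  symmetric E -> irreflexive E -> (0 < #|V|)%N -> (forall i, 0 <= h i) ->
  Gamma_star E h = Delta_star E h /\
  exists g : R, Gamma_star E h = g%:E /\
    forall eps : R, 0 < eps ->
      exists beta0 : R, forall beta : R, beta0 < beta ->
        expR (2 * beta * (g - eps)) <= tau_plus E h beta /\
        tau_plus E h beta <= expR (2 * beta * (g + eps)).
Proof.
move=> Esym Eirr V0 _; split; first exact: Gamma_star_eq_Delta_star.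
pose C : R := \sum_(S : {set V}) `|tilt E h S|.
have fC (S : {set V}) : `|tilt E h S| <= C.
  by rewrite /C (bigD1 S)//= lerDl sumr_ge0.
have C0 : 0 <= C by apply: le_trans (fC set0).
have n1 : 1 <= #|V|%:R :> R by rewrite ler1n.
have N1 : 1 <= #|{: config V}|%:R :> R.
  by rewrite ler1n; apply/card_gt0P; exists (allplus V).
have VT : set0 != setT :> {set V}.
  by apply: contraTneq V0 => e; rewrite -cardsT -e cards0.
have GC : (Gamma_star E h <= (2 * C)%:E)%E.
  apply/Gamma_star_le => // B _; apply: reach_everywhere => S.
  by have := fC S; have := fC B; rewrite !ler_norml => /andP[? ?] /andP[? ?]; lra.
(* The path from the empty set already has its start at or below level [L] above its own energy.
   This excludes the value [-oo]. *)
have G0 (L : R) : (Gamma_star E h <= L%:E)%E -> 0 <= L.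
  by move=> /Gamma_star_le => /(_ Esym _ VT) /reach_start_le; rewrite lerDl.
have [g Gg] : exists g : R, Gamma_star E h = g%:E.
  case: (Gamma_star E h) GC G0 => [g _ _|//|_ G0]; first by exists g.
  by have := G0 (-1) (leNye _); rewrite ler0N1.
exists g; split=> // eps eps0.
have g0 : 0 <= g by apply: G0; rewrite Gg.
have rg : forall B, B != setT -> reach (tilt E h) (tilt E h B + g) B setT.
  by apply/Gamma_star_le; rewrite ?Gg.
(* Only half of [eps] is given up on the barrier; the other half absorbs the prefactor [K]. *)
have [B0 B0T nB0] : exists2 B, B != setT &
    ~ reach (tilt E h) (tilt E h B + (g - eps / 2)) B setT.
  apply: contrapT => none; have : (Gamma_star E h <= (g - eps / 2)%:E)%E.
    apply/Gamma_star_le => // B BT; apply: contrapT => nB; apply: none; by exists B.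
  by rewrite Gg lee_fin; lra.
have [B [BB0 nB minB]] := reach_from_min nB0.
have BT : B != setT by apply: contraNneq B0T => e; rewrite e subTset in BB0.
set n : R := #|V|%:R in n1; set N : R := #|{: config V}|%:R in N1.
pose K := 4 * n * N; pose c := 8 * n ^+ 2 * N * (1 + N + 2 * C).
have K0 : 0 <= K by apply: mulr_ge0; lra.
have d0 : 0 <= 8 * n ^+ 2 * N.
  by apply: mulr_ge0; [rewrite mulr_ge0 ?sqr_ge0 | lra].
have c0 : 0 <= c by apply: mulr_ge0 => //; lra.
(* Beyond this threshold [K <= beta * eps <= expR (beta * eps)]. Also [beta * c], which bounds the
   prefactor of [t] once [beta >= 1], is at most [(beta * eps) ^+ 2], hence at most
   [expR (2 * beta * eps)]. *)
exists (1 + K / eps + c / eps ^+ 2) => beta beta_gt.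
have Ke : 0 <= K / eps := divr_ge0 K0 (ltW eps0).
have ce : 0 <= c / eps ^+ 2 := divr_ge0 c0 (sqr_ge0 eps).
have b1 : 1 <= beta by lra.
have b0 : 0 <= beta by lra.
have bK : K <= beta * eps by rewrite -ler_pdivrMr//; lra.
have bc : c <= beta * eps ^+ 2 by rewrite -ler_pdivrMr ?exprn_gt0//; lra.
pose t := 8 * n ^+ 2 * N * (1 + N + 2 * beta * C) * expR (2 * beta * g).
have upper x : surv E h beta x t <= expR (- 1) := surv_upper Esym Eirr b0 V0 g0 fC rg x.
have t0 : 0 <= t.
  by rewrite mulr_ge0 ?expR_ge0// mulr_ge0//; have := mulr_ge0 b0 C0; lra.
split.
  apply: le_trans (le_bigmax _ _ (config_of B)).
  (* A lower bound on [inf] requires a nonempty set of times; the upper estimate supplies [t]. *)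
  apply: lb_le_inf; first by exists t; split=> //; apply: upper.
  move=> s [s0 surv1].
  have := surv_lower Esym Eirr b0 V0 BT nB minB s0 surv1.
  rewrite -/n -/N -/K => low.
  have Kx : K <= expR (beta * eps) by apply: le_trans bK _; have := expR_ge1Dx (beta * eps); lra.
  have := le_trans low (ler_wpM2r s0 Kx).
  have -> : 2 * beta * (g - eps / 2) = beta * eps + 2 * beta * (g - eps) by field.
  by rewrite expRD ler_pM2l ?expR_gt0.
apply: (@le_trans _ _ t); last first.
  rewrite /t [2 * beta * (g + _)]mulrDr expRD [leLHS]mulrC; apply: ler_wpM2l; first exact: expR_ge0.
  apply: (@le_trans _ _ (beta * c)).
    have -> : beta * c = 8 * n ^+ 2 * N * (beta * (1 + N) + 2 * beta * C) by rewrite /c; ring.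
    apply: ler_wpM2l => //; rewrite lerD2r ler_peMl//; lra.
  have -> : 2 * beta * eps = beta * eps + beta * eps by ring.
  rewrite expRD; apply: (@le_trans _ _ (beta * eps * (beta * eps))).
    by have := ler_wpM2l b0 bc; rewrite expr2; lra.
  have be : 0 <= beta * eps by lra.
  have : beta * eps <= expR (beta * eps) by have := expR_ge1Dx (beta * eps); lra.
  by move=> le1; apply: ler_pM.
apply/bigmax_leP; split=> // x _; apply: ge_inf; last by split=> //; apply: upper.
by exists 0 => s [].
Qed.
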